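(* Let $r>s\ge1$ be integers and let $G=\overline{\langle a_1,\dots,a_r\rangle}\subset W$ be the closed subgroup topologically generated by the elements $a_1,\dots,a_r\in W$ determined by $a_1=\sigma$, $a_{s+1}=(a_s,a_r)$, and $a_i=(a_{i-1},1)$ for $i\ne1,s+1$. For any elements $b_1,\dots,b_r\in W$ the following are equivalent: (a) $b_1$ is conjugate to $\sigma$ under $W$, $b_{s+1}$ is conjugate to $(b_s,b_r)$ under $W$, and $b_i$ is conjugate to $(b_{i-1},1)$ under $W$ for all $i\ne1,s+1$. (b) $b_i$ is conjugate to $a_i$ under $W$ for any $1\le i\le r$. (c) There exist $w\in W$ and $x_1,\dots,x_r\in G$ such that $b_i=(wx_i)a_i(wx_i)^{-1}$ for any $1\le i\le r$. Moreover, for any $w$ as in (c), the closed subgroup of $W$ topologically generated by $b_1,\dots,b_r$ is equal to $wGw^{-1}$.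
   Context: $T$ is the infinite rooted binary tree whose vertices are the finite words over $\{0,1\}$, with root the empty word, each word $t$ being joined by an edge to $t0$ and $t1$. $W:=\operatorname{Aut}(T)$ is its automorphism group, a profinite group as the inverse limit of the finite groups $W_n=\operatorname{Aut}(T_n)$, where $T_n\subset T$ is the subtree of words of length $\le n$. For $u,v\in W$, $(u,v)\in W$ denotes the automorphism $0t\mapsto 0\,u(t)$, $1t\mapsto 1\,v(t)$ for all words $t$; $\sigma\in W$ is the automorphism of order $2$ with $0t\mapsto 1t$ and $1t\mapsto 0t$. Thus $W=(W\times W)\rtimes\langle\sigma\rangle$. The recursion relations for $a_1,\dots,a_r$ have a unique solution in $W$. *)

(* Defs.v *)
From HB Require Import structures.
From mathcomp Require Import all_boot all_order.
From mathcomp Require Import boolp classical_sets filter topology.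

Set Implicit Arguments.
Unset Strict Implicit.
Unset Printing Implicit Defensive.

Local Open Scope classical_set_scope.

(* Vertices of the infinite rooted binary tree T: words over {0,1}, written
   left to right, with the letters 0 and 1 encoded as [false] and [true]. *)
Definition word := seq bool.

Definition adjacent : rel word := fun s t =>
  [exists c : bool, t == rcons s c] || [exists c : bool, s == rcons t c].

(* W = Aut(T). *)
Record W := TreeAut {
  tree_fun :> word -> word;
  tree_fun_bij : bijective tree_fun;
  tree_fun_root : tree_fun [::] = [::];
  tree_fun_adjacent : {mono tree_fun : s t / adjacent s t} }.

Lemma W_eq (f g : W) : (forall t, f t = g t) -> f = g.
Proof.
case: f g => [f bf rf ef] [g bg rg eg] /= /funext fg.
by subst g; congr TreeAut; exact: Prop_irrelevance.
Qed.

Lemma adjacent_cons c d s t :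
  adjacent (c :: s) (d :: t) = (c == d) && adjacent s t.
Proof.
rewrite /adjacent; apply/idP/idP.
  by case/orP=> /existsP[x /eqP[-> ->]]; rewrite eqxx /=; apply/orP;
    [left|right]; apply/existsP; exists x.
by case/andP=> /eqP-> /orP[] /existsP[x /eqP->]; apply/orP; [left|right];
  apply/existsP; exists x.
Qed.

Lemma adjacentC s t : adjacent s t = adjacent t s.
Proof. by rewrite /adjacent orbC. Qed.

Lemma adjacent_nil s : adjacent [::] s = (size s == 1).
Proof.
rewrite /adjacent; apply/idP/idP.
  by case/orP=> /existsP[x /eqP]; [move->|case: s].
by case: s => [|c [|]] // _; apply/orP; left; apply/existsP; exists c.
Qed.

Definition oneW : W :=
  @TreeAut id (Bijective (fun=> erefl) (fun=> erefl)) erefl (fun _ _ => erefl).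

(* The product is composition of maps: (f * g)(t) = f(g(t)). *)
Fact mulW_adjacent (f g : W) : {mono (f \o g) : s t / adjacent s t}.
Proof. by move=> s t; rewrite /= !tree_fun_adjacent. Qed.

Fact mulW_root (f g : W) : (f \o g) [::] = [::].
Proof. by rewrite /= !tree_fun_root. Qed.

Definition mulW (f g : W) : W :=
  TreeAut (bij_comp (tree_fun_bij f) (tree_fun_bij g))
    (mulW_root f g) (@mulW_adjacent f g).

Fact invW_subproof (f : W) : exists g : W, cancel f g /\ cancel g f.
Proof.
have [g fK gK] := tree_fun_bij f.
have gr : g [::] = [::] by rewrite -{1}(tree_fun_root f) fK.
have ge : {mono g : s t / adjacent s t}.
  by move=> s t; rewrite -(tree_fun_adjacent f) !gK.
by exists (TreeAut (Bijective gK fK) gr ge).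
Qed.

Definition invW (f : W) : W := projT1 (cid (invW_subproof f)).

Lemma invWK (f : W) : cancel f (invW f) /\ cancel (invW f) f.
Proof. by rewrite /invW; case: cid. Qed.

Fact mulWA : associative mulW. Proof. by move=> *; exact: W_eq. Qed.
Fact mul1W : left_id oneW mulW. Proof. by move=> *; exact: W_eq. Qed.
Fact mulW1 : right_id oneW mulW. Proof. by move=> *; exact: W_eq. Qed.
Fact mulVW : left_inverse oneW invW mulW.
Proof. by move=> f; apply: W_eq => t /=; rewrite (invWK f).1. Qed.
Fact mulWV : right_inverse oneW invW mulW.
Proof. by move=> f; apply: W_eq => t /=; rewrite (invWK f).2. Qed.

HB.instance Definition _ := gen_eqMixin W.
HB.instance Definition _ := gen_choiceMixin W.
HB.instance Definition _ := isGroup.Build W mulWA mul1W mulW1 mulVW mulWV.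

(* The profinite topology of W = lim W_n: as f and g have the same image in
   W_n exactly when they agree on all words of length <= n, the fibres of
   W -> W_n are the sets [level_ball f n]. *)
Definition level_ball (f : W) (n : nat) : set W :=
  [set g : W | forall t : word, size t <= n -> g t = f t].

HB.instance Definition _ := hasNbhs.Build W
  (fun f => filter_from [set: nat] (level_ball f)).

Fact nbhsW_filter (f : W) : ProperFilter (nbhs f).
Proof.
apply: filter_from_proper; last by move=> n _; exists f.
apply: filter_fromT_filter; first by exists 0.
move=> m n; exists (maxn m n) => g fg.
by split=> t tn; apply: fg; rewrite leq_max tn ?orbT.
Qed.

Fact nbhsW_singleton (f : W) (A : set W) : nbhs f A -> A f.
Proof. by move=> [n _]; apply. Qed.

Fact nbhsW_nbhs (f : W) (A : set W) : nbhs f A -> nbhs f (nbhs^~ A).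
Proof.
move=> [n _ fA]; exists n => // g fg; exists n => // h gh.
by apply: fA => t tn; rewrite gh // fg.
Qed.

HB.instance Definition _ := Nbhs_isNbhsTopological.Build W
  nbhsW_filter nbhsW_singleton nbhsW_nbhs.

(* [tree_pair u v] is the automorphism (u,v). *)
Definition tree_pair_fun (u v : word -> word) (t : word) : word :=
  match t with
  | [::] => [::]
  | false :: t' => false :: u t'
  | true :: t' => true :: v t'
  end.

Lemma tree_eq_nil (f : W) t : (f t == [::]) = (t == [::]).
Proof. by rewrite -{1}(tree_fun_root f) (inj_eq (bij_inj (tree_fun_bij f))). Qed.

Fact tree_pair_bij (u v : W) : bijective (tree_pair_fun u v).
Proof.
have [[uK uK'] [vK vK']] := (invWK u, invWK v).
by exists (tree_pair_fun (invW u) (invW v)); case=> // -[] t /=;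
  rewrite ?uK ?uK' ?vK ?vK'.
Qed.

Fact tree_pair_adjacent (u v : W) :
  {mono (tree_pair_fun u v) : s t / adjacent s t}.
Proof.
have nilE c s : adjacent [::] (tree_pair_fun u v (c :: s)) =
                adjacent [::] (c :: s).
  by rewrite !adjacent_nil; case: c => /=;
    rewrite !eqSS !size_eq0 tree_eq_nil.
move=> [|c s] [|d t].
- by [].
- exact: (nilE d t).
- by rewrite adjacentC [RHS]adjacentC; exact: (nilE c s).
by case: c d => -[] /=; rewrite !adjacent_cons //= tree_fun_adjacent.
Qed.

Definition tree_pair (u v : W) : W :=
  TreeAut (tree_pair_bij u v) erefl (@tree_pair_adjacent u v).

Definition sigma_fun (t : word) : word :=
  if t is c :: t' then ~~ c :: t' else [::].

Fact sigma_funK : involutive sigma_fun.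
Proof. by case=> // c t /=; rewrite negbK. Qed.

Fact sigma_adjacent : {mono sigma_fun : s t / adjacent s t}.
Proof.
move=> [|c s] [|d t] //; first by rewrite !adjacent_nil.
  by rewrite adjacentC [RHS]adjacentC !adjacent_nil.
by rewrite /= !adjacent_cons (inj_eq negb_inj).
Qed.

Definition sigma : W := TreeAut (inv_bij sigma_funK) erefl sigma_adjacent.

Definition conjugate (x y : W) : Prop := exists w : W, x = (w * y * w^-1)%g.

Definition generated (S : set W) : set W :=
  smallest (fun H : set W => group_closed [in H]) S.

Definition top_generated (S : set W) : set W := closure (generated S).

(* Main.v *)
From mathcomp Require Import all_boot all_fingroup all_solvable.
From mathcomp Require Import zify.
Require Import Defs.
From mathcomp Require Import all_boot all_order.
From mathcomp Require Import boolp classical_sets filter topology.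

(* By compactness of W it suffices to work modulo the level stabilizers, by
   induction on the level.  For (b) => (c) one may assume b_1 = sigma; after
   conjugation by 1 or sigma the other b_i become pairs (c_(i-1), 1) and
   (c_s, c_r) with c_j conjugate to a_j, and induction gives
   c_j = (u y_j) a_j (u y_j)^-1 with y_j in <a_1, ..., a_r>.  Conjugation by
   (u, u) fixes sigma, and the obstruction left over in (c_s, c_r) is removed by
   replacing u by u z^-1, where (z, z y_s^-1 y_r a_r^e) lies in
   <a_1, ..., a_r>; such z exists because a_s and a_r generate a dihedral
   quotient.  For the last claim, the image of G at each level is a finite
   2-group, whose maximal subgroups are normal, so that arbitrary conjugates of
   its generators generate it. *)

Local Open Scope classical_set_scope.

Section TreeAutomorphisms.

Set Implicit Arguments.
Unset Strict Implicit.
Unset Printing Implicit Defensive.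

Local Open Scope group_scope.

Implicit Types (f g h u v w x y : W) (t : word) (n : nat).

(** * Tree automorphisms preserve the levels *)

Lemma mulWE f g t : (f * g) t = f (g t). Proof. by []. Qed.

Lemma mulVWE f t : f^-1 (f t) = t.
Proof. by rewrite -mulWE mulVg. Qed.

Lemma mulWVE f t : f (f^-1 t) = t.
Proof. by rewrite -mulWE mulgV. Qed.

Lemma tree_inj f : injective f.
Proof. exact: can_inj (mulVWE f). Qed.

Lemma adjacent_size t t' :
  adjacent t t' -> (size t' == (size t).+1) || (size t == (size t').+1).
Proof. by case/orP=> /existsP[c /eqP->]; rewrite size_rcons eqxx ?orbT. Qed.

Lemma adjacent_rcons t c : adjacent t (rcons t c).
Proof. by apply/orP; left; apply/existsP; exists c. Qed.

Lemma adjacent_parent t t1 t2 : adjacent t t1 -> adjacent t t2 ->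
  size t1 < size t -> size t2 < size t -> t1 = t2.
Proof.
have parentP t' : adjacent t t' -> size t' < size t -> exists c, t = rcons t' c.
  by case/orP=> /existsP[c /eqP->]; rewrite ?size_rcons; [lia|exists c].
move=> adj1 adj2 /(parentP _ adj1)[c1 tE1] /(parentP _ adj2)[c2].
by rewrite {1}tE1 => /rcons_inj[].
Qed.

(** The image of a child could fail to be one level deeper only by being the parent of the image,
    and by injectivity that place is taken by the image of the parent. Hence the induction carries a
    word together with its children. *)
Lemma size_tree f t : size (f t) = size t.
Proof.
suff [] : size (f t) = size t /\ forall c, size (f (rcons t c)) = (size t).+1.
  by [].
elim/last_ind: t => [|t d [IHt IHd]].
  rewrite tree_fun_root; split=> // c.
  have : adjacent [::] (f [:: c]).
    by rewrite -{1}(tree_fun_root f) tree_fun_adjacent adjacent_nil.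
  by rewrite adjacent_nil => /eqP.
split=> [|c]; first by rewrite IHd size_rcons.
have adj : adjacent (f (rcons t d)) (f (rcons (rcons t d) c)).
  by rewrite tree_fun_adjacent adjacent_rcons.
have adj' : adjacent (f (rcons t d)) (f t).
  by rewrite tree_fun_adjacent adjacentC adjacent_rcons.
have /orP[/eqP->|/eqP sz] := adjacent_size adj; first by rewrite IHd size_rcons.
have /tree_inj/(congr1 size) : f (rcons (rcons t d) c) = f t.
  by apply: (adjacent_parent adj adj'); [rewrite sz | rewrite IHd IHt].
by rewrite !size_rcons; lia.
Qed.

(** * The decomposition of W as (W x W) extended by sigma *)

Lemma tree_pairM u v x y :
  tree_pair u v * tree_pair x y = tree_pair (u * x) (v * y).
Proof. by apply: W_eq => -[|[] t]. Qed.

Lemma tree_pair1 : tree_pair 1 1 = 1.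
Proof. by apply: W_eq => -[|[] t]. Qed.

Lemma tree_pairV u v : (tree_pair u v)^-1 = tree_pair u^-1 v^-1.
Proof.
apply: (mulgI (tree_pair u v)).
by rewrite mulgV tree_pairM !mulgV tree_pair1.
Qed.

Lemma sigma_sqr : sigma * sigma = 1.
Proof. by apply: W_eq => -[|[] t]. Qed.

Lemma sigma_pair u v : sigma * tree_pair u v = tree_pair v u * sigma.
Proof. by apply: W_eq => -[|[] t]. Qed.

(** Lengthening a nonempty word by a letter moves its image along an edge that avoids the root, and
    such an edge keeps the first letter. *)
Lemma tree_hd f c t : ohead (f (c :: t)) = ohead (f [:: c]).
Proof.
elim/last_ind: t => [//|t d <-].
have : adjacent (f (c :: t)) (f (rcons (c :: t) d)).
  by rewrite tree_fun_adjacent adjacent_rcons.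
have := size_tree f (c :: t); have := size_tree f (rcons (c :: t) d).
rewrite -rcons_cons.
case: (f (c :: t)) (f (rcons _ _)) => [|x p] [|y q] //= _ _.
by rewrite adjacent_cons => /andP[/eqP-> _].
Qed.

Lemma tree_first_level f : exists b, forall c, f [:: c] = [:: c (+) b].
Proof.
have single c : exists d, f [:: c] = [:: d].
  by have := size_tree f [:: c]; case: (f [:: c]) => [|d []] // _; exists d.
have [[d0 f0] [d1 f1]] := (single false, single true).
have d01 : d0 != d1.
  by apply/eqP => dE; have := @tree_inj f [:: false] [:: true];
    rewrite f0 f1 dE => /(_ erefl).
by exists d0; case; rewrite ?f0 ?f1; case: d0 d1 d01 {f0 f1} => [] [].
Qed.

(** On each of the two subtrees, deleting the first letter turns the restriction of [f] into an
    automorphism, whose inverse comes from [f^-1] in the same way. *)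
Lemma tree_pairP f : (forall c, f [:: c] = [:: c]) ->
  exists u v, f = tree_pair u v.
Proof.
have consE g : (forall c, g [:: c] = [:: c]) ->
    forall c t, g (c :: t) = c :: behead (g (c :: t)).
  move=> gfix c t; have := tree_hd g c t; rewrite gfix.
  by case: (g (c :: t)) => [|d p] //= [->].
move=> ffix; have fVfix c : f^-1 [:: c] = [:: c] by rewrite -{1}ffix mulVWE.
have [fE fVE] := (consE f ffix, consE f^-1 fVfix).
have branch c : exists u, forall t, f (c :: t) = c :: u t.
  have hK : cancel (behead \o f \o cons c) (behead \o f^-1 \o cons c).
    by move=> t /=; rewrite -fE mulVWE.
  have hK' : cancel (behead \o f^-1 \o cons c) (behead \o f \o cons c).
    by move=> t /=; rewrite -fVE mulWVE.
  have hadj : {mono behead \o f \o cons c : t t' / adjacent t t'}.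
    move=> t t' /=; have := tree_fun_adjacent f (c :: t) (c :: t').
    by rewrite fE (fE c t') !adjacent_cons eqxx.
  have hroot : (behead \o f \o cons c) [::] = [::] by rewrite /= ffix.
  by exists (TreeAut (Bijective hK hK') hroot hadj) => t; rewrite [LHS]fE.
have [[u uE] [v vE]] := (branch false, branch true).
by exists u, v; apply: W_eq => -[|[] t]; rewrite ?tree_fun_root ?uE ?vE.
Qed.

Lemma tree_decomp f : exists u v,
  f = tree_pair u v \/ f = sigma * tree_pair u v.
Proof.
have [[] fb] := tree_first_level f.
  have [u [v E]] : exists u v, sigma * f = tree_pair u v.
    by apply: tree_pairP => c; rewrite mulWE fb; case: c.
  by exists u, v; right; rewrite -E mulgA sigma_sqr mul1g.
by have [|u [v ->]] := @tree_pairP f; [case; rewrite fb | exists u, v; left].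
Qed.

(** * Conjugacy in W *)

Lemma conjugate_refl x : conjugate x x.
Proof. by exists 1; rewrite invg1 mul1g mulg1. Qed.

Lemma conjugate_trans y x z : conjugate x y -> conjugate y z -> conjugate x z.
Proof. by move=> [v ->] [w ->]; exists (v * w); rewrite invgM !mulgA. Qed.

Lemma conjugate_sym x y : conjugate x y -> conjugate y x.
Proof.
by move=> [v ->]; exists v^-1; rewrite invgK !mulgA mulgKV mulVg mul1g.
Qed.

Lemma conjugate_conj w x y : conjugate x y -> conjugate (w^-1 * x * w) y.
Proof. by apply: conjugate_trans; exists w^-1; rewrite invgK. Qed.

Lemma conjugate_pair u v x y : conjugate u x -> conjugate v y ->
  conjugate (tree_pair u v) (tree_pair x y).
Proof.
move=> [w1 ->] [w2 ->]; exists (tree_pair w1 w2).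
by rewrite tree_pairV !tree_pairM.
Qed.

(** Of a conjugator [tau * (w1, w2)], the pair is absorbed into the two entries, so that only [tau]
    remains outside. *)
Lemma conjugate_tree_pair x u v : conjugate x (tree_pair u v) ->
  exists tau p q, [/\ tau = 1 \/ tau = sigma,
    x = tau * tree_pair p q * tau^-1, conjugate p u & conjugate q v].
Proof.
move=> [w ->]; have [w1 [w2 wE]] := tree_decomp w.
have [tau tauE ->] : exists2 tau, tau = 1 \/ tau = sigma &
    w = tau * tree_pair w1 w2.
  by case: wE => ->; [exists 1; [left|rewrite mul1g] | exists sigma; [right|]].
exists tau, (w1 * u * w1^-1), (w2 * v * w2^-1); split=> //.
- by rewrite invgM -!tree_pairM -tree_pairV !mulgA.
- by exists w1.
- by exists w2.
Qed.

(** * Congruence modulo the level stabilizers, that is, equality in W_n *)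

Definition agree n f g : Prop := forall t, size t <= n -> f t = g t.

Lemma agree_refl n f : agree n f f. Proof. by []. Qed.

Lemma agree_sym n f g : agree n f g -> agree n g f.
Proof. by move=> fg t tn; rewrite fg. Qed.

Lemma agree_trans n g f h : agree n f g -> agree n g h -> agree n f h.
Proof. by move=> fg gh t tn; rewrite fg // gh. Qed.

Lemma agree_leq m n f g : m <= n -> agree n f g -> agree m f g.
Proof. by move=> mn fg t tm; apply: fg; exact: leq_trans mn. Qed.

Lemma agreeM n f g u v : agree n f g -> agree n u v -> agree n (f * u) (g * v).
Proof. by move=> fg uv t tn; rewrite !mulWE uv // fg // size_tree. Qed.

Lemma agreeV n f g : agree n f g -> agree n f^-1 g^-1.
Proof.
by move=> fg t tn; apply: (@tree_inj f); rewrite mulWVE fg ?mulWVE ?size_tree.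
Qed.

Lemma agree_conj n w x f g : agree n w x -> agree n f g ->
  agree n (w * f * w^-1) (x * g * x^-1).
Proof. by move=> wx fg; apply: agreeM; [apply: agreeM | apply: agreeV]. Qed.

Lemma agree_pair n f g u v : agree n f g -> agree n u v ->
  agree n.+1 (tree_pair f u) (tree_pair g v).
Proof. by move=> fg uv [|[] t] //= tn; rewrite ?fg ?uv. Qed.

Lemma agree0 f g : agree 0 f g.
Proof. by case=> // _; rewrite !tree_fun_root. Qed.

Lemma agree_eq f g : (forall n, agree n f g) -> f = g.
Proof. by move=> fg; apply: W_eq => t; exact: (fg (size t)). Qed.

(** * Ultralimits of sequences in W *)

Lemma ultra_finite_range (T : Type) (U : set_system T) (A : eqType)
    (F : T -> A) (s : seq A) :
  UltraFilter U -> (forall i, F i \in s) -> exists z, U [set i | F i = z].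
Proof.
move=> UU Fs; have : U [set i | F i \in s] by apply: filterS filterT => i _ /=.
elim: s {Fs} => [|z s IHs] Us.
  by case: (@filter_not_empty _ U _); apply: filterS Us => i.
have [Uz|Uz] := in_ultra_setVsetC [set i | F i = z] UU; first by exists z.
apply: IHs; apply: filterS (filterI Us Uz) => i [] /=.
by rewrite inE => /orP[/eqP|].
Qed.

(* Compactness of W. *)
Lemma W_ultralimit : exists U : set_system nat, [/\ UltraFilter U,
  forall m, U [set n | m <= n] &
  forall f : nat -> W, exists g, forall m, U [set n | agree m (f n) g]].
Proof.
have [U [UU Uoo]] := ultraFilterLemma eventually_filter.
exists U; split=> [//|m|f]; first by apply: Uoo; exists m.
have limit (h : nat -> W) : exists k : word -> word,
    forall t, U [set n | h n t = k t].
  have ex t : exists z, U [set n | h n t = z].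
    pose words := map val (enum {: (size t).-tuple bool}).
    apply: (@ultra_finite_range _ _ _ _ words).
    move=> n; apply/mapP; have /eqP szt := size_tree (h n) t.
    by exists (Tuple szt); rewrite ?mem_enum.
  by have [k kE] := choice ex; exists k.
(* The limits of the maps and of their inverses are taken separately. Any identity between finitely
   many of their values already holds at some index [n], which makes them mutually inverse
   automorphisms. *)
have [[k kE] [l lE]] := (limit f, limit (fun n => (f n)^-1)).
have kK : cancel k l.
  move=> t; have [n /= [<- <-]] := filter_ex (filterI (kE t) (lE (k t))).
  by rewrite mulVWE.
have lK : cancel l k.
  move=> t; have [n /= [<- <-]] := filter_ex (filterI (lE t) (kE (l t))).
  by rewrite mulWVE.
have kroot : k [::] = [::].
  by have [n /= <-] := filter_ex (kE [::]); rewrite tree_fun_root.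
have kadj : {mono k : t t' / adjacent t t'}.
  move=> t t'; have [n /= [<- <-]] := filter_ex (filterI (kE t) (kE t')).
  by rewrite tree_fun_adjacent.
exists (TreeAut (Bijective kK lK) kroot kadj) => m.
(* The words of length at most [m] are packed into a finite type, so that finitely many members of
   [U] are intersected. *)
have : U [set n | forall t : {i : 'I_m.+1 & i.-tuple bool},
    f n (val (tagged t)) = k (val (tagged t))].
  by apply: filter_forall => t; exact: kE.
apply: filterS => n /= fk t; rewrite -ltnS => tm.
pose t' : (Ordinal tm).-tuple bool := in_tuple t.
exact: (fk (Tagged (fun i : 'I_m.+1 => i.-tuple bool) t')).
Qed.

(** A proper [H] would lie in a maximal subgroup, which is normal in a p-group; containing a
    conjugate of each element of [A], it would contain [A] itself. *)
Lemma pgroup_gen_conj (gT : finGroupType) (p : nat) (A : {set gT})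
    (H : {group gT}) :
  p.-group <<A>> -> H \subset <<A>> ->
  {in A, forall x : gT, exists2 y : gT, y \in <<A>> & x ^ y \in H} ->
  H :=: <<A>>.
Proof.
move=> pA sHA AH; have [//|[M maxM sHM]] := maximal_exists sHA.
have /andP[_ nMA] := p_maximal_normal pA maxM.
have /andP[_ /negP[]] := maxgroupp maxM; rewrite gen_subG.
apply/fintype.subsetP=> x xA; have [y yA xyH] := AH x xA.
by rewrite -(memJ_norm x (fintype.subsetP nMA y yA)) (fintype.subsetP sHM).
Qed.

(** * Generated subgroups and their closures *)

Lemma sub_generated (S : set W) : S `<=` generated S.
Proof. exact: sub_gen_smallest. Qed.

Lemma group_closed_set (H : set W) : H 1 ->
  (forall x y, H x -> H y -> H (x * y^-1)) -> group_closed [in H].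
Proof.
move=> H1 HMV; split; first by rewrite inE.
by move=> x y; rewrite !inE; exact: HMV.
Qed.

Lemma generated_subgroup (S H : set W) : S `<=` H -> H 1 ->
  (forall x y, H x -> H y -> H (x * y^-1)) -> generated S `<=` H.
Proof.
by move=> SH H1 HMV; apply: smallest_sub => //; exact: group_closed_set.
Qed.

Lemma generated1 (S : set W) : generated S 1.
Proof. by move=> H [[H1 _] _]; have := H1; rewrite inE. Qed.

Lemma generatedMV (S : set W) x y :
  generated S x -> generated S y -> generated S (x * y^-1).
Proof.
move=> Sx Sy H HP; have [[_ HMV] _] := HP.
by have := HMV x y; rewrite !inE; apply; [exact: Sx | exact: Sy].
Qed.

Lemma generatedV (S : set W) x : generated S x -> generated S x^-1.
Proof.
move=> Sx; rewrite -(mul1g x^-1).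
exact: (@generatedMV S _ _ (@generated1 S) Sx).
Qed.

Lemma generatedM (S : set W) x y :
  generated S x -> generated S y -> generated S (x * y).
Proof.
move=> Sx Sy; rewrite -(invgK y).
exact: (@generatedMV S _ _ Sx (@generatedV S _ Sy)).
Qed.

Lemma generated_conj (S : set W) x y :
  generated S x -> generated S y -> generated S (x * y * x^-1).
Proof.
move=> Sx Sy.
exact: (@generatedMV S _ _ (@generatedM S _ _ Sx Sy) Sx).
Qed.

(** The elements that preserve [P] under left multiplication, together with their inverses, form a
    subgroup containing [S]; it is then applied to the element 1 of [P]. *)
Lemma generated_ind (S P : set W) : P 1 ->
  (forall x y, S x -> P y -> P (x * y)) ->
  (forall x y, S x -> P y -> P (x^-1 * y)) -> generated S `<=` P.
Proof.
move=> P1 PM PVM g Sg; rewrite -(mulg1 g).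
suff [H _] : (forall y, P y -> P (g * y)) /\ (forall y, P y -> P (g^-1 * y)).
  exact: H.
pose Q := [set x |
  (forall y, P y -> P (x * y)) /\ (forall y, P y -> P (x^-1 * y))].
move: g Sg; apply: (@generated_subgroup S Q).
- by move=> x Sx; split=> y; [apply: PM | apply: PVM].
- by split=> y; rewrite ?invg1 mul1g.
move=> x y [Px PVx] [Py PVy]; split=> z Pz.
  by rewrite -mulgA; exact/Px/PVy.
by rewrite invgM invgK -mulgA; exact/Py/PVx.
Qed.

Lemma top_generatedP (S : set W) x :
  top_generated S x <-> forall n, exists2 y, generated S y & agree n y x.
Proof.
split=> [Sx n|Sx B [n _ nB]].
  have [|y [Sy xy]] := Sx (level_ball x n); first by exists n.
  by exists y.
by have [y Sy xy] := Sx n; exists y; split=> //; exact: nB.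
Qed.

Lemma sub_top_generated (S : set W) : generated S `<=` top_generated S.
Proof. by move=> x Sx; apply/top_generatedP => n; exists x. Qed.

(** * The images at finite levels are 2-groups *)

(** A square acts trivially on the first level, hence is a pair, and the induction applies to both
    entries. *)
Lemma expg_pow2_agree n g : agree n (g ^+ (2 ^ n)) 1.
Proof.
elim: n g => [|n IHn] g; first exact: agree0.
have [u [v guv]] : exists u v, g ^+ 2 = tree_pair u v.
  have [u [v [->|->]]] := tree_decomp g; rewrite expgS expg1.
    by rewrite tree_pairM; exists (u * u), (v * v).
  exists (v * u), (u * v).
  rewrite {1}sigma_pair mulgA -(mulgA _ sigma sigma) sigma_sqr mulg1.
  exact: tree_pairM.
have pairX m : tree_pair u v ^+ m = tree_pair (u ^+ m) (v ^+ m).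
  elim: m => [|m IHm]; first by rewrite !expg0 tree_pair1.
  by rewrite !expgS IHm tree_pairM.
rewrite expnS expgM guv pairX -tree_pair1.
by apply: agree_pair; exact: IHn.
Qed.

(** The image of a parent is determined as the unique neighbour, nearer to the root, of the image of
    its child. *)
Lemma agree_top n f g : (forall t, size t = n -> f t = g t) -> agree n f g.
Proof.
elim: n => [|n IHn] fg t; first by rewrite leqn0 size_eq0 => /eqP->; exact: fg.
rewrite leq_eqVlt => /orP[/eqP|]; first exact: fg.
rewrite ltnS; apply: IHn => {}t tn.
have parent h : adjacent (h (rcons t false)) (h t).
  by rewrite tree_fun_adjacent adjacentC adjacent_rcons.
have ftE : f (rcons t false) = g (rcons t false).
  by apply: fg; rewrite size_rcons tn.
apply: (@adjacent_parent (f (rcons t false)));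
  rewrite ?size_tree ?size_rcons //.
by rewrite ftE.
Qed.

(* The inverse turns composition of maps into the product of {perm _}, which
   applies its left factor first. *)
Definition level_perm_fun n g (t : n.-tuple bool) : n.-tuple bool :=
  Tuple (introT eqP (etrans (size_tree g^-1 t) (size_tuple t))).

Fact level_perm_inj n g : injective (@level_perm_fun n g).
Proof. by move=> t t' /(congr1 val) /tree_inj /val_inj. Qed.

Definition level_perm n g : {perm n.-tuple bool} := perm (@level_perm_inj n g).

Lemma level_permM n : {morph level_perm n : g h / g * h}.
Proof.
move=> g h; apply/perm.permP => t; apply: val_inj.
by rewrite permM !permE /= invgM.
Qed.

Lemma level_perm1 n : level_perm n 1 = 1.
Proof. by apply: (mulgI (level_perm n 1)); rewrite -level_permM !mulg1. Qed.

Lemma level_permV n : {morph level_perm n : g / g^-1}.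
Proof.
move=> g; apply: (mulgI (level_perm n g)).
by rewrite -level_permM !mulgV level_perm1.
Qed.

Lemma level_permP n g h : level_perm n g = level_perm n h <-> agree n g h.
Proof.
split=> [gh|/agreeV gh]; last first.
  by apply/perm.permP => t; apply: val_inj; rewrite !permE /= gh // size_tuple.
rewrite -(invgK g) -(invgK h); apply: agreeV; apply: agree_top => t /eqP tn.
by have /perm.permP/(_ (Tuple tn))/(congr1 val) := gh; rewrite !permE.
Qed.

Definition level_image n (S : set W) : {set {perm n.-tuple bool}} :=
  finset (fun p => `[< exists2 g, S g & level_perm n g = p >]).

Lemma level_imageP n (S : set W) p :
  reflect (exists2 g, S g & level_perm n g = p) (p \in level_image n S).
Proof. by rewrite inE; exact: asboolP. Qed.

Lemma level_image_generated n (S : set W) :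
  level_image n (generated S) = <<level_image n S>>.
Proof.
have gS : group_set (level_image n (generated S)).
  apply/group_setP; split.
    by apply/level_imageP; exists 1; [exact: generated1 | exact: level_perm1].
  move=> _ _ /level_imageP[g Sg <-] /level_imageP[h Sh <-].
  apply/level_imageP.
  by exists (g * h); [exact: generatedM | exact: level_permM].
apply/eqP; rewrite finset.eqEsubset; apply/andP; split; last first.
  rewrite (gen_subG _ (fingroup.Group gS)).
  apply/fintype.subsetP => _ /level_imageP[g Sg <-].
  by apply/level_imageP; exists g => //; exact: sub_generated.
apply/fintype.subsetP => _ /level_imageP[g Sg <-]; move: g Sg.
pose H := [set g | level_perm n g \in <<level_image n S>>]%classic.
apply: (@generated_subgroup S H) => [g Sg||x y].
- by apply/mem_gen/level_imageP; exists g.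
- by rewrite /H /= level_perm1 group1.
by rewrite /H /= level_permM level_permV => xS yS; rewrite groupM ?groupV.
Qed.

(** By Cauchy, a prime divisor of the order is the order of some element, and the 2^n-th power of
    that element is trivial. *)
Lemma level_image_pgroup n (S : set W) : 2.-group <<level_image n S>>.
Proof.
apply/pgroupP => q q_pr /(Cauchy q_pr)[x].
rewrite /= -level_image_generated => /level_imageP[g _ <-] ordg.
have : q %| 2 ^ n.
  have levelX m : level_perm n (g ^+ m) = level_perm n g ^+ m.
    elim: m => [|m IHm]; first by rewrite !expg0 level_perm1.
    by rewrite !expgS level_permM IHm.
  rewrite -ordg order_dvdn -levelX -(level_perm1 n).
  by apply/eqP/level_permP; exact: expg_pow2_agree.
by rewrite Euclid_dvdX // => /andP[]; rewrite dvdn_prime2.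
Qed.

(** Modulo level [n] this takes place in a finite 2-group, where [pgroup_gen_conj] applies to the
    conjugated generators. *)
Lemma generated_conj_agree (I : set nat) (a b x : nat -> W) n :
  (forall i, I i -> generated [set a i | i in I] (x i) /\
     agree n (b i) (x i * a i * (x i)^-1)) ->
  forall g, generated [set a i | i in I] g ->
  exists2 h, generated [set b i | i in I] h & agree n h g.
Proof.
move=> bE g ag; pose A := [set a i | i in I]; pose B := [set b i | i in I].
suff BA : <<level_image n B>> = <<level_image n A>>.
  have : level_perm n g \in <<level_image n B>>.
    by rewrite BA -level_image_generated; apply/level_imageP; exists g.
  rewrite -level_image_generated => /level_imageP[h Bh /level_permP hg].
  by exists h.
have levelE i : I i ->
    level_perm n (b i) = level_perm n (a i) ^ (level_perm n (x i))^-1.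
  move=> Ii; rewrite conjgE invgK mulgA -level_permV -!level_permM.
  exact/level_permP/(bE i Ii).2.
have xA i : I i -> level_perm n (x i) \in <<level_image n A>>.
  move=> Ii; rewrite -level_image_generated.
  by apply/level_imageP; exists (x i) => //; exact: (bE i Ii).1.
have aA i : I i -> level_perm n (a i) \in <<level_image n A>>.
  by move=> Ii; apply/mem_gen/level_imageP; exists (a i) => //; exists i.
apply: (@pgroup_gen_conj _ 2); first exact: level_image_pgroup.
  rewrite gen_subG; apply/fintype.subsetP => _ /level_imageP[_ [i Ii <-] <-].
  by rewrite levelE // groupJ ?groupV ?xA ?aA.
move=> _ /level_imageP[_ [i Ii <-] <-].
exists (level_perm n (x i))^-1; first by rewrite groupV xA.
rewrite -levelE //; apply/mem_gen/level_imageP.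
by exists (b i) => //; exists i.
Qed.

Lemma top_generatedMV (S : set W) x y :
  top_generated S x -> top_generated S y -> top_generated S (x * y^-1).
Proof.
move=> /top_generatedP Sx /top_generatedP Sy; apply/top_generatedP => n.
have [[x' Sx' xx'] [y' Sy' yy']] := (Sx n, Sy n).
exists (x' * y'^-1); first exact: (@generatedMV S _ _ Sx' Sy').
by apply: agreeM => //; exact: agreeV.
Qed.

(** An ultralimit of the conjugators found at the single levels works at all levels. *)
Lemma conjugate_limit x y :
  (forall n, exists w, agree n x (w * y * w^-1)) -> conjugate x y.
Proof.
move=> /choice[w xE]; have [U [UU Uoo Ulim]] := W_ultralimit.
have [v wv] := Ulim w; exists v; apply: agree_eq => m.
have [n /= [mn wvm]] := filter_ex (filterI (Uoo m) (wv m)).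
by apply: agree_trans (agree_leq mn (xE n)) _; exact: agree_conj.
Qed.

(** * The recursion relations and the equivalence of (a) and (b) *)

(** Merges the special relation at index [s.+1] with the ordinary ones, so that one induction treats
    both. *)
Definition second_entry (r s : nat) (a : nat -> W) (i : nat) : W :=
  if i == s then a r else 1.

(** With [R] equality these are the equations for the a_i, with [R] conjugacy they are condition
    (a). *)
Definition recursion_rel (R : W -> W -> Prop) (r s : nat) (a : nat -> W) :
    Prop :=
  R (a 1%N) sigma /\ forall i, 0 < i < r ->
    R (a i.+1) (tree_pair (a i) (second_entry r s a i)).

Lemma recursion_relE (R : W -> W -> Prop) (r s : nat) (a : nat -> W) :
  0 < s < r ->
  recursion_rel R r s a <-> [/\ R (a 1%N) sigma,
    R (a s.+1) (tree_pair (a s) (a r)) &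
    forall i, 0 < i <= r -> i <> 1%N -> i <> s.+1 ->
      R (a i) (tree_pair (a i.-1) 1)].
Proof.
move=> sr; split=> [[a1 aS]|[a1 as1 ai]].
  split=> //; first by have := aS s sr; rewrite /second_entry eqxx.
  case=> [|[|i]] // ir _ /eqP; rewrite eqSS => /negPf iNs.
  by have := aS i.+1 ir; rewrite /second_entry iNs.
split=> // i ir; rewrite /second_entry; case: eqP => [->//|iNs].
by apply: (ai i.+1); lia.
Qed.

Definition generators (r : nat) (a : nat -> W) : set W :=
  [set a i | i in [set i : nat | 0 < i <= r]].

(** From (a) to (b), [conjugate_limit] reduces to one level, and forming pairs raises the level by
    one: entries conjugate modulo level [n] give pairs conjugate modulo level [n.+1]. For the
    converse, the entries of the pair equal to [a i.+1] are replaced by their conjugates. *)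
Lemma conjugate_recursion (r s : nat) (a b : nat -> W) : 0 < s < r ->
  recursion_rel eq r s a ->
  recursion_rel conjugate r s b <->
  forall i, 0 < i <= r -> conjugate (b i) (a i).
Proof.
move=> sr [a1 aS]; split=> [[b1 bS] i ir|ba].
  apply: conjugate_limit => n; elim: n i ir => [|n IHn] [|[|i]] // ir.
  - by exists 1; exact: agree0.
  - by exists 1; exact: agree0.
  - by have [w ->] := b1; exists w; rewrite a1; exact: agree_refl.
  have [w ->] := bS i.+1 ir.
  have [u bu] := IHn i.+1 (ltnW ir).
  have [v bv] : exists v, agree n (second_entry r s b i.+1)
      (v * second_entry r s a i.+1 * v^-1).
    rewrite /second_entry; case: eqP => _; first by apply: IHn; lia.
    by exists 1; rewrite !mul1g invg1; exact: agree_refl.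
  exists (w * tree_pair u v).
  have -> : w * tree_pair u v * a i.+2 * (w * tree_pair u v)^-1 =
      w * (tree_pair u v * a i.+2 * (tree_pair u v)^-1) * w^-1.
    by rewrite invgM !mulgA.
  apply: agree_conj => //; rewrite aS // tree_pairV !tree_pairM.
  exact: agree_pair.
split=> [|i ir]; first by rewrite -a1; apply: ba; lia.
apply: (@conjugate_trans (a i.+1)); first by apply: ba; lia.
rewrite aS //; apply/conjugate_pair/conjugate_sym.
  by apply/conjugate_sym/ba; lia.
rewrite /second_entry; case: eqP => _; first by apply: ba; lia.
exact: conjugate_refl.
Qed.

(** * The group generated by the a_i *)

Lemma generator_sqr (r s : nat) (a : nat -> W) i : 0 < s < r ->
  recursion_rel eq r s a -> 0 < i <= r -> a i * a i = 1.
Proof.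
move=> sr [a1 aS] ir; apply: agree_eq => n.
elim: n i ir => [|n IHn] [|[|i]] // ir; try exact: agree0.
  by rewrite a1 sigma_sqr.
rewrite aS // tree_pairM -tree_pair1; apply: agree_pair.
  by apply: IHn; lia.
rewrite /second_entry; case: eqP => _; first by apply: IHn; lia.
by rewrite mulg1.
Qed.

Lemma generator_mem (r : nat) (a : nat -> W) i :
  0 < i <= r -> generated (generators r a) (a i).
Proof. by move=> ir; apply: sub_generated; exists i. Qed.

Lemma generated_swap (r s : nat) (a : nat -> W) u v : 0 < s < r ->
  recursion_rel eq r s a ->
  generated (generators r a) (tree_pair u v) ->
  generated (generators r a) (tree_pair v u).
Proof.
move=> sr [a1 _] uv.
have -> : tree_pair v u = sigma * tree_pair u v * sigma^-1.
  by rewrite sigma_pair mulgK.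
apply: generated_conj => //; rewrite -a1; apply: generator_mem; lia.
Qed.

(** This is self-similarity: [a i] with [i < r] is the first entry of [a i.+1], while [a r] is the
    second entry of [a s.+1] and comes first after conjugation by sigma. *)
Lemma generated_section (r s : nat) (a : nat -> W) y : 0 < s < r ->
  recursion_rel eq r s a -> generated (generators r a) y ->
  exists z, generated (generators r a) (tree_pair y z).
Proof.
move=> sr arec.
have gen i : 0 < i <= r ->
    exists z, generated (generators r a) (tree_pair (a i) z).
  move=> ir; have [iltr|ilr] := ltnP i r.
    exists (second_entry r s a i); rewrite -arec.2; last by lia.
    by apply: generator_mem; lia.
  exists (a s); have -> : i = r by lia.
  apply: (generated_swap sr arec).
  have := arec.2 s sr; rewrite /second_entry eqxx => <-.
  by apply: generator_mem; lia.
move: y; apply: generated_ind.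
- by exists 1; rewrite tree_pair1; exact: generated1.
- move=> _ y [i ir <-] [z yz]; have [v av] := gen i ir.
  by exists (v * z); rewrite -tree_pairM; exact: (@generatedM _ _ _ av yz).
move=> _ y [i ir <-] [z yz]; have [v av] := gen i ir.
exists (v^-1 * z); rewrite -tree_pairM -tree_pairV.
exact: (@generatedM _ _ _ (@generatedV _ _ av) yz).
Qed.

(* Let N be the group of all n with (1, n) in the group Gamma generated by the
   a_i.  It is normalized by Gamma and contains all a_j with j <> s, r, so
   modulo N the group Gamma is dihedral, generated by the involutions a_s and
   a_r.  The elements d with (z, z d) in Gamma for some z in Gamma contain 1
   and are stable under d |-> d^-1 and d |-> a_s d a_r, so that they include
   all rotations. *)
Lemma generated_twist (r s : nat) (a : nat -> W) y : 0 < s < r ->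
  recursion_rel eq r s a -> generated (generators r a) y ->
  exists z e, generated (generators r a) z /\
    generated (generators r a) (tree_pair z (z * y * a r ^+ e)).
Proof.
move=> sr arec; set Gam := generated (generators r a).
have GamM u v : Gam u -> Gam v -> Gam (u * v) by exact: generatedM.
have GamV u : Gam u -> Gam u^-1 by exact: generatedV.
have Gam_gen i : 0 < i <= r -> Gam (a i) by exact: generator_mem.
have sqr i : 0 < i <= r -> a i * a i = 1 by exact: (generator_sqr sr arec).
have [s_r r_r] : 0 < s <= r /\ 0 < r <= r by lia.
pose N := [set n : W | Gam (tree_pair 1 n)].
have NM u v : N u -> N v -> N (u * v).
  by move=> Nu Nv; have := GamM _ _ Nu Nv; rewrite tree_pairM mulg1.
have NJ g v : Gam g -> N v -> N (g * v * g^-1).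
  (* Conjugating (1, v) by an element (z, g) of [Gam] gives (1, g v g^-1). *)
  move=> Gg Nv; have [z gz] := generated_section sr arec Gg.
  have zg := generated_swap sr arec gz.
  have := @generated_conj _ _ _ zg Nv.
  by rewrite tree_pairV !tree_pairM mulg1 mulgV.
have N_gen i : 0 < i <= r -> i <> s -> i <> r -> N (a i).
  move=> ir /eqP/negPf iNs iNr; apply: (generated_swap sr arec).
  have := arec.2 i; rewrite /second_entry iNs => <-; last by lia.
  by apply: Gam_gen; lia.
(* The last two conditions say that conjugation by the involutions [a s] and [a r] inverts [d], as
   it does for powers of their product. *)
pose rot := [set d : W |
  [/\ Gam d, exists2 z, Gam z & Gam (tree_pair z (z * d)),
  a s * d = d^-1 * a s & a r * d = d^-1 * a r]].
have rot1 : rot 1.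
  have G1 : Gam 1 by exact: generated1.
  split; rewrite ?invg1 ?mulg1 ?mul1g //.
  by exists 1; rewrite ?mulg1 ?tree_pair1.
have invJ u d : u * d = d^-1 * u -> u * d^-1 = d * u.
  by move=> ud; apply: (mulgI d^-1); rewrite mulKg mulgA -ud mulgK.
have rotV d : rot d -> rot d^-1.
  move=> [Gd [z Gz zd] ds dr].
  split; rewrite ?invgK; [exact: GamV| |exact: invJ..].
  (* Swapping (z, z d) gives (z d, z), whose second entry is (z d) d^-1. *)
  exists (z * d); first exact: GamM.
  by rewrite mulgK; exact: (generated_swap sr arec).
have selfV i : 0 < i <= r -> (a i)^-1 = a i.
  by move=> ir; apply: (mulgI (a i)); rewrite mulgV sqr.
have rotS d : rot d -> rot (d * a s * a r).
  move=> rd; have [Gd _ ds dr] := rd; have [_ [z Gz zd] _ _] := rotV d rd.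
  have dV : (d * a s * a r)^-1 = a r * a s * d^-1.
    by rewrite !invgM !selfV // mulgA.
  split; first exact: (GamM _ _ (GamM _ _ Gd (Gam_gen _ s_r)) (Gam_gen _ r_r)).
  (* The product (z, z d^-1) (a_s, a_r) is the required pair, because a_s (d a_s a_r) = d^-1 a_r. *)
  - exists (z * a s); first exact: (GamM _ _ Gz (Gam_gen _ s_r)).
    have asr : Gam (tree_pair (a s) (a r)).
      have := arec.2 s sr; rewrite /second_entry eqxx => <-.
      by apply: Gam_gen; lia.
    have -> : z * a s * (d * a s * a r) = z * d^-1 * a r.
      rewrite !mulgA -(mulgA z) ds !mulgA -(mulgA _ (a s) (a s)) sqr //.
      by rewrite mulg1.
    by have := GamM _ _ zd asr; rewrite tree_pairM.
  - rewrite dV !mulgA ds -(mulgA (a r) (a s)) (invJ _ _ ds) !mulgA.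
    by rewrite -!(mulgA _ (a s) (a s)) sqr // !mulg1 dr.
  by rewrite dV !mulgA -(mulgA (a r) (a s)) (invJ _ _ ds) !mulgA dr.
(* Normal form in [Gam]: an element of [N], a rotation and a power of the reflection [a r]. *)
pose P := [set u : W | exists v d e, [/\ N v, rot d & u = v * d * a r ^+ e]].
have P_gen i u : 0 < i <= r -> P u -> P (a i * u).
  move=> ir [v [d [e [Nv rd ->]]]]; have [Gd _ ds dr] := rd.
  have NvJ := NJ _ _ (Gam_gen i ir) Nv.
  have shift : a i * (v * d * a r ^+ e) =
      a i * v * (a i)^-1 * (a i * d) * a r ^+ e by rewrite !mulgA mulgKV.
  have [is_|ins] := eqVneq i s.
    (* Writing a_s = (a_s a_r) a_r puts one part into the rotation and the other into the
       exponent. *)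
    exists (a i * v * (a i)^-1), (d^-1 * a s * a r), e.+1; split=> //.
      by apply: rotS; exact: rotV.
    rewrite shift is_ ds expgS !mulgA -(mulgA _ (a r) (a r)) sqr //.
    by rewrite mulg1.
  have [ir_|inr] := eqVneq i r.
    exists (a i * v * (a i)^-1), d^-1, e.+1; split=> //; first exact: rotV.
    by rewrite shift ir_ dr expgS !mulgA.
  exists (a i * v), d, e; split=> //; last by rewrite !mulgA.
  by apply: NM => //; apply: N_gen => //; exact/eqP.
move=> Gy; have [v [d [e [Nv rd ->]]]] : P y.
  move: y Gy; apply: generated_ind.
  - exists 1, 1, 0%N; split=> //; last by rewrite expg0 !mulg1.
    by rewrite /N /= tree_pair1; exact: generated1.
  - by move=> _ u [i ir <-]; exact: P_gen.
  by move=> _ u [i ir <-]; rewrite selfV //; exact: P_gen.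
have [Gd [z Gz zd] _ _] := rd; exists z, e; split=> //.
(* The two powers of [a r] cancel, and (1, z v z^-1) (z, z d) = (z, z v d). *)
have -> : z * (v * d * a r ^+ e) * a r ^+ e = z * v * z^-1 * (z * d).
  have re : a r ^+ e * a r ^+ e = 1.
    by rewrite -expgMn // sqr // expg1n.
  by rewrite !mulgA -(mulgA _ (_ ^+ _)) re mulg1 mulgKV.
by have := GamM _ _ (NJ z v Gz Nv) zd; rewrite tree_pairM mul1g.
Qed.

(** * From (b) to (c), first modulo a level and then in the limit *)

(** The statement ranges over all [b] because the induction applies it to the entries of the pairs.
    The range condition stands inside [exists x] so that choice yields a function on all of
    [nat]. *)
Lemma conjugate_agree (r s : nat) (a : nat -> W) n : 0 < s < r ->
  recursion_rel eq r s a -> forall b : nat -> W,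
  (forall i, 0 < i <= r -> conjugate (b i) (a i)) ->
  exists w, forall i, exists x, 0 < i <= r ->
    generated (generators r a) x /\ agree n (b i) (w * x * a i * (w * x)^-1).
Proof.
move=> sr arec; have [a1 aS] := arec.
set Gam := generated (generators r a).
have GamM u v : Gam u -> Gam v -> Gam (u * v) by exact: generatedM.
have GamV u : Gam u -> Gam u^-1 by exact: generatedV.
have [s_r r_r] : 0 < s <= r /\ 0 < r <= r by lia.
elim: n => [|n IHn] b ba.
  exists 1 => i; exists 1 => _; split; [exact: generated1 | exact: agree0].
have [g b1] : conjugate (b 1%N) sigma by rewrite -a1; apply: ba; lia.
have /choice[tpq tpqE] : forall i, exists tpq : W * W * W, 0 < i < r ->
    let: (tau, p, q) := tpq in
    [/\ tau = 1 \/ tau = sigma,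
        b i.+1 = g * (tau * tree_pair p q * tau^-1) * g^-1,
        conjugate p (a i) & conjugate q (second_entry r s a i)].
  move=> i; have [ir|ir] := boolP (0 < i < r); last by exists (1, 1, 1).
  have : conjugate (g^-1 * b i.+1 * g) (tree_pair (a i) (second_entry r s a i)).
    by rewrite -aS //; apply/conjugate_conj/ba; lia.
  move=> /conjugate_tree_pair[tau [p [q [tauE bE pa qa]]]].
  by exists (tau, p, q) => _; split=> //; rewrite -bE !mulgA mulgV mul1g mulgK.
pose p i := (tpq i).1.2; pose q i := (tpq i).2; pose tau i := (tpq i).1.1.
have {}tpqE i : 0 < i < r -> [/\ tau i = 1 \/ tau i = sigma,
    b i.+1 = g * (tau i * tree_pair (p i) (q i) * (tau i)^-1) * g^-1,
    conjugate (p i) (a i) & conjugate (q i) (second_entry r s a i)].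
  by move/tpqE; rewrite /p /q /tau; case: (tpq i) => [[]].
(* The pairs provide first entries [p i] only for [i < r]; at index [r] the second entry [q s] of
   the pair for [b s.+1] takes over, being conjugate to [a r]. *)
have ca i : 0 < i <= r -> conjugate (if i == r then q s else p i) (a i).
  move=> ir; case: eqP => [->|/eqP iNr]; last first.
    by have [|_ _ pa _] := tpqE i; first lia.
  by have [_ _ _ +] := tpqE s sr; rewrite /second_entry eqxx.
have [u /choice[y uy]] := IHn (fun i => if i == r then q s else p i) ca.
have Gy i : 0 < i <= r -> Gam (y i) by case/uy.
have [z [e [Gz zr]]] :=
  generated_twist sr arec (GamM _ _ (GamV _ (Gy s s_r)) (Gy r r_r)).
(* With these choices [y' s = z], so [generated_twist] places the pair of [y' s] and
   [y' r * a r ^+ e] in [Gam]. The products [u * y i] are unchanged, and the power of [a r] commutes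
   with [a r]. *)
pose y' i := z * ((y s)^-1 * y i); pose w0 := u * y s * z^-1.
have w0y i : w0 * y' i = u * y i by rewrite /w0 /y' !mulgA mulgKV mulgK.
have Gy' i : 0 < i <= r -> Gam (y' i).
  by move=> ir; exact: (GamM _ _ Gz (GamM _ _ (GamV _ (Gy s s_r)) (Gy i ir))).
have second i : 0 < i < r -> exists x, Gam (tree_pair (y' i) x) /\
    agree n (q i) (w0 * x * second_entry r s a i * (w0 * x)^-1).
  move=> ir; rewrite /second_entry; case: eqP => [->|iNs].
    exists (y' r * a r ^+ e); split; first by rewrite /y' mulVg mulg1.
    have [_] := uy r r_r; rewrite eqxx mulgA w0y (invgM (u * y r)).
    by rewrite -(mulgA _ (a r ^+ e) (a r)) -expgSr expgS (mulgA (u * y r)) mulgA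
      mulgK.
  (* The second entry is trivial here, so any [x] that completes [y' i] to a pair in [Gam] will
     do. *)
  have [x yx] := generated_section sr arec (Gy' i ltac:(lia)).
  exists x; split=> //; have [_ _ _ +] := tpqE i ir.
  rewrite /second_entry; case: eqP => // _ [v ->].
  by rewrite !mulg1 !mulgV; exact: agree_refl.
have wsigma : tree_pair w0 w0 * sigma = sigma * tree_pair w0 w0.
  by rewrite sigma_pair.
(* Index 0 is out of range. At index 1 the trivial [x] suffices, since (w0, w0) commutes with
   sigma. *)
exists (g * tree_pair w0 w0) => -[|[|i]]; first by exists 1.
  exists 1 => _; split; first exact: generated1.
  by rewrite a1 b1 mulg1 -(mulgA g _ sigma) wsigma invgM !mulgA mulgK.
have [ir|ir] := boolP (0 < i.+1 < r); last by exists 1 => ir'; case/negP: ir.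
have [x [yx qx]] := second i.+1 ir.
have [tauE -> _ _] := tpqE i.+1 ir.
exists (tau i.+1 * tree_pair (y' i.+1) x) => _; split.
  apply: (GamM _ _ _ yx); case: tauE => ->; first exact: generated1.
  by rewrite -a1; apply: generator_mem; lia.
have -> : g * tree_pair w0 w0 * (tau i.+1 * tree_pair (y' i.+1) x) =
    g * (tau i.+1 * tree_pair (u * y i.+1) (w0 * x)).
  rewrite -!(mulgA g); congr (g * _); rewrite mulgA -w0y -tree_pairM mulgA.
  by case: tauE => ->; rewrite ?wsigma // mulg1 mul1g.
have -> f h k : g * (f * h) * k * (g * (f * h))^-1 =
    g * (f * (h * k * h^-1) * f^-1) * g^-1 by rewrite !invgM !mulgA.
apply: agree_conj => //; apply: agree_conj => //.
rewrite aS // tree_pairV !tree_pairM; apply: agree_pair => //.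
have [_ +] := uy i.+1 ltac:(lia).
by case: eqP => // iE; move: ir; rewrite -iE ltnn andbF.
Qed.

(** The ultralimits of the conjugators [w n] and of the [x n i] are taken along one ultrafilter; the
    latter limits lie in the closure. *)
Lemma conjugate_generated (r s : nat) (a b : nat -> W) : 0 < s < r ->
  recursion_rel eq r s a ->
  (forall i, 0 < i <= r -> conjugate (b i) (a i)) ->
  exists w (x : nat -> W), forall i, 0 < i <= r ->
    top_generated (generators r a) (x i) /\
    b i = w * x i * a i * (w * x i)^-1.
Proof.
move=> sr arec ba.
have [w wE] := choice (fun n => conjugate_agree n sr arec ba).
pose x n := projT1 (choice (wE n)).
have xE n : forall i, 0 < i <= r -> generated (generators r a) (x n i) /\
    agree n (b i) (w n * x n i * a i * (w n * x n i)^-1).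
  exact: projT2 (choice (wE n)).
have [U [UU Uoo Ulim]] := W_ultralimit.
have [v wv] := Ulim w.
have [z xz] := choice (fun i => Ulim (x^~ i)).
exists v, z => i ir; split.
  apply/top_generatedP => m; have [n /= xzn] := filter_ex (xz i m).
  by exists (x n i) => //; exact: (xE n i ir).1.
apply: agree_eq => m.
have [n /= [mn [wvn xzn]]] :=
  filter_ex (filterI (Uoo m) (filterI (wv m) (xz i m))).
apply: agree_trans (agree_leq mn (xE n i ir).2) _.
by apply: agree_conj => //; exact: agreeM.
Qed.

(** * The closed subgroup generated by the b_i *)

(** One inclusion holds because the closure of the group of the a_i contains all w^-1 b_i w. For the
    other, at each level the [x i] are replaced by elements of the abstract group, where
    [generated_conj_agree] applies. *)
Lemma top_generated_conj (I : set nat) (a b x : nat -> W) w :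
  (forall i, I i -> top_generated [set a i | i in I] (x i) /\
     b i = w * x i * a i * (w * x i)^-1) ->
  top_generated [set b i | i in I] =
  [set w * g * w^-1 | g in top_generated [set a i | i in I]].
Proof.
move=> bE; apply/seteqP; split=> [y yb|_ [g ga <-]].
  exists (w^-1 * y * w); last by rewrite !mulgA mulgV mul1g mulgK.
  have Gb : generated [set b i | i in I] `<=`
      [set h | top_generated [set a i | i in I] (w^-1 * h * w)].
    apply: generated_subgroup => [_ [i Ii <-]||f h] /=.
    - have [Gx ->] := bE i Ii.
      have -> : w^-1 * (w * x i * a i * (w * x i)^-1) * w =
          x i * a i * (x i)^-1.
        by rewrite invgM !mulgA mulVg mul1g mulgKV.
      apply: (top_generatedMV _ Gx); rewrite -(invgK (a i)).
      apply: (top_generatedMV Gx); apply: sub_top_generated.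
      by apply: generatedV; apply: sub_generated; exists i.
    - by rewrite mulg1 mulVg; apply: sub_top_generated; exact: generated1.
    move=> Gf Gh; have := top_generatedMV Gf Gh.
    by rewrite !invgM invgK !mulgA mulgK.
  apply/top_generatedP => n.
  have [h hb hy] := (top_generatedP _ _).1 yb n.
  have [k ka kh] := (top_generatedP _ _).1 (Gb h hb) n.
  exists k => //; apply: agree_trans kh _.
  by rewrite -{2 4}(invgK w); exact: agree_conj.
apply/top_generatedP => n; have [k ka kg] := (top_generatedP _ _).1 ga n.
have /choice[y yE] : forall i, exists y, I i ->
    generated [set a i | i in I] y /\ agree n y (x i).
  move=> i; have [Ii|nIi] := pselect (I i); last by exists 1.
  by have [y ya yx] := (top_generatedP _ _).1 (bE i Ii).1 n; exists y.
(* This is w^-1 b_i w, a conjugate of [a i] inside the closed group; [w] is put back at the end. *)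
pose b' i := x i * a i * (x i)^-1.
have b'E i : I i -> generated [set a i | i in I] (y i) /\
    agree n (b' i) (y i * a i * (y i)^-1).
  move=> Ii; have [ya yx] := yE i Ii; split=> //.
  by apply: agree_conj; [exact: agree_sym | exact: agree_refl].
have [h hb hk] := generated_conj_agree b'E ka.
exists (w * h * w^-1); last by apply: agree_conj => //; exact: agree_trans kg.
move: h hb {hk}; apply: generated_subgroup => [_ [i Ii <-]||f h] /=.
- apply: sub_generated; exists i => //.
  by have [_ ->] := bE i Ii; rewrite /b' invgM !mulgA.
- by rewrite mulg1 mulgV; exact: generated1.
move=> fb hb; have := @generatedMV _ _ _ fb hb.
by rewrite !invgM invgK !mulgA mulgKV.
Qed.

End TreeAutomorphisms.

Theorem theorem3p4p1 (r s : nat) (s_ge1 : 1 <= s) (r_gt_s : s < r)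
    (a : nat -> W)
    (a_1 : a 1 = sigma)
    (a_s1 : a s.+1 = tree_pair (a s) (a r))
    (a_i : forall i : nat, 1 <= i <= r -> i <> 1 -> i <> s.+1 ->
       a i = tree_pair (a i.-1) 1%g)
    (b : nat -> W) :
  let G : set W := top_generated [set a i | i in [set i : nat | 1 <= i <= r]] in
  let cond_a : Prop :=
    [/\ conjugate (b 1) sigma,
        conjugate (b s.+1) (tree_pair (b s) (b r)) &
        forall i : nat, 1 <= i <= r -> i <> 1 -> i <> s.+1 ->
          conjugate (b i) (tree_pair (b i.-1) 1%g)] in
  let cond_b : Prop :=
    forall i : nat, 1 <= i <= r -> conjugate (b i) (a i) in
  let conj_by (w : W) : Prop :=
    exists x : nat -> W, forall i : nat, 1 <= i <= r ->
      G (x i) /\ b i = (w * x i * a i * (w * x i)^-1)%g in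
  let cond_c : Prop := exists w : W, conj_by w in
  [/\ cond_a <-> cond_b,
      cond_b <-> cond_c &
      forall w : W, conj_by w ->
        top_generated [set b i | i in [set i : nat | 1 <= i <= r]] =
        [set (w * g * w^-1)%g | g in G]].
Proof.
move=> G cond_a cond_b conj_by cond_c.
have sr : 0 < s < r by rewrite s_ge1.
have arec : recursion_rel eq r s a by apply/recursion_relE.
split.
- apply: iff_trans (conjugate_recursion b sr arec).
  exact: iff_sym (recursion_relE conjugate b sr).
- split=> [/(conjugate_generated sr arec)[w [x bE]]|[w [x bE]] i ir].
    by exists w, x.
  by exists (w * x i)%g; have [] := bE i ir.
by move=> w [x bE]; exact: top_generated_conj bE.
Qed.
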